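(* (a) For every $\epsilon>0$ there is an integer $g$ such that $\gamma_e(G)\leq\epsilon\, n(G)$ for every cubic graph $G$ of girth at least $g$. (b) For every real $\alpha$ with $0<\alpha<\frac{2}{3\ln 2}$, there are infinitely many cubic graphs $G$ with $\gamma_e(G)\leq\dfrac{3n(G)}{(\ln n(G))^{\alpha}}$.
   Context: All graphs are finite, simple and undirected; $n(G)=|V(G)|$; a graph is cubic if every vertex has degree $3$. For a graph $G$, a set $S\subseteq V(G)$, and vertices $u,v$ with $u\in S$ or $v\in S$, ${\rm dist}_{(G,S)}(u,v)$ is the minimum number of edges of a path $P$ in $G$ between $u$ and $v$ such that $S$ contains exactly one endvertex of $P$ and no internal vertex of $P$, and $\infty$ if no such path exists (so ${\rm dist}_{(G,S)}(u,u)=0$ for $u\in S$). For $u\in V(G)$, $w_{(G,S)}(u)=\sum_{v\in S}(1/2)^{{\rm dist}_{(G,S)}(u,v)-1}$ with $(1/2)^{\infty}=0$. $S$ is an exponential dominating set of $G$ if $w_{(G,S)}(u)\geq 1$ for every $u\in V(G)$, and $\gamma_e(G)$ is the minimum cardinality of an exponential dominating set of $G$. *)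

(* Defs.v *)
From HB Require Import structures.
From mathcomp Require Import all_boot all_order all_algebra.
Set Implicit Arguments. Unset Strict Implicit. Unset Printing Implicit Defensive.
Import Order.TTheory GRing.Theory Num.Theory.

Section Graphs.
Variable T : finType.
Variable e : rel T.

Definition simple_graph : Prop := symmetric e /\ irreflexive e.

Definition cubic : Prop := forall v : T, #|[set w | e v w]| = 3.

Definition is_cycle (c : seq T) : Prop :=
  (3 <= size c)%N /\ uniq c /\ cycle e c.

Definition girth_ge (g : nat) : Prop :=
  forall c : seq T, is_cycle c -> (g <= size c)%N.

Definition reach (S : {set T}) (a b : T) (k : nat) : bool :=
  [exists p : k.-tuple T,
     [&& path (fun x y => e x y && (x \notin S)) a p,
         uniq (a :: p) & last a p == b]].

(* dist_(G,S)(u,v): None encodes infinity.  A path with exactly one endvertex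
   in S and no internal vertex in S is, read from its endvertex outside S,
   a path whose vertices are all outside S except the last one. A path has
   fewer than #|T| edges, so searching k < #|T| is exhaustive. *)
Definition distS (S : {set T}) (u v : T) : option nat :=
  if (u \in S) == (v \in S) then
    (if (u == v) && (u \in S) then Some 0%N else None)
  else
    let a := if u \in S then v else u in
    let b := if u \in S then u else v in
    let k := find (reach S a b) (iota 0 #|T|) in
    if (k < #|T|)%N then Some k else None.

(* w_(G,S)(u) = sum_{v in S} (1/2)^(dist(u,v) - 1) = sum 2 / 2^dist. *)
Definition expw (S : {set T}) (u : T) : rat :=
  (\sum_(v in S)
     match distS S u v with
     | Some d => 2%:R / (2%:R ^+ d)
     | None => 0
     end)%R.

Definition exp_dominating (S : {set T}) : bool :=
  [forall u, (1 <= expw S u)%R].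

(* gamma_e(G): minimum cardinality of an exponential dominating set
   (the whole vertex set is always one, so #|T| is a valid default). *)
Definition gamma_e : nat :=
  \big[minn/#|T|]_(S : {set T} | exp_dominating S) #|S|.

End Graphs.

(* Main.v *)
(** In a cubic graph of girth greater than [2 r], the weight at a vertex [u]
    outside [S] is at least [3] times the probability that a uniform
    nonbacktracking walk of length [r] from [u] meets [S], so it suffices that
    [S] meets a third of these walks.  As each walk has [r] distinct vertices,
    choosing greedily [k] vertices leaves a fraction of at most
    [(1 - r / n) ^ k] of all walks unmet; by Markov's inequality at most
    [3 / 2 * n * exp (- r k / n)] vertices are bad, and they are added to [S].
    With [k] about [n ln r / r] this gives
    [gamma_e <= n (ln r + 5 / 2) / r], hence (a).

    For (b), where [2 / (3 ln 2) < 1], any explicit family of cubic graphs whose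
    girth is at least a constant times [ln n] is enough.  The three reflections
    in the sides of an ideal hyperbolic triangle generate a free product of three groups
    of order two in [GL_2(Z)], by ping-pong; reduced modulo [m] they have no
    relation of length less than a constant times [ln m], as the matrix entries
    of a word grow at most exponentially. *)
Require Import Defs.
From mathcomp Require Import all_boot all_order all_algebra.
From mathcomp Require Import zify ring.
Set Implicit Arguments. Unset Strict Implicit. Unset Printing Implicit Defensive.
Import Order.TTheory GRing.Theory Num.Theory.

(** * Nonbacktracking walks *)

Section NonBacktracking.
Variables (T : finType) (e : rel T).
Hypotheses (e_sym : symmetric e) (e_irr : irreflexive e).

(** [x] is the vertex visited just before [y]. A walk without past is encoded by [x = y]: in a graph
    without loops the test [z != y] then excludes nothing. *)
Fixpoint nbw (x y : T) (p : seq T) : bool :=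
  if p is z :: p' then [&& e y z, z != x & nbw y z p'] else true.

Lemma nbw_start x y p : nbw x y p -> nbw y y p.
Proof.
case: p => //= z p /and3P[eyz _ ->]; rewrite eyz andbT.
by apply: contraTneq eyz => ->; rewrite e_irr.
Qed.

Lemma nbw_path x y p : nbw x y p -> path e y p.
Proof. by elim: p x y => //= z p IHp x y /and3P[-> _ /IHp ->]. Qed.

(** By induction only [y] can recur; its next occurrence closes a cycle shorter than [g], with at
    least three vertices because the walk does not backtrack. *)
Lemma nbw_uniq g x y p :
  girth_ge e g -> nbw x y p -> size p < g -> uniq (y :: p).
Proof.
move=> girth; elim: p x y => // z p IHp x y /= /and3P[eyz _ nb_p] lt_p_g.
have /= -> := IHp y z nb_p (ltnW lt_p_g); rewrite andbT.
apply: contraTN lt_p_g; rewrite -leqNgt inE => /predU1P[y_z | y_p].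
  by rewrite y_z e_irr in eyz.
have := IHp y z nb_p; move: (nbw_path nb_p) (nb_p).
case/splitPr: y_p => p1 p2 /=; rewrite cat_path /= => /and3P[ez e_y _] nb.
have [lt_g uniq_p | le_g] := ltnP (size (p1 ++ y :: p2)) g; last by move=> _; apply: leqW.
have := uniq_p isT; rewrite mem_cat cat_uniq inE !negb_or /=.
case/and5P=> /and3P[zp1 zy _] up1 yp1 _ _.
have cyc : is_cycle e [:: y, z & p1].
  split; last split.
  - by case: p1 nb {ez e_y lt_g uniq_p zp1 up1 yp1} => //=; rewrite eqxx andbF.
  - by rewrite /= inE negb_or eq_sym zy zp1 up1 !andbT; case: (boolP (y \in p1)) yp1.
  - by rewrite /= eyz rcons_path ez.
by apply: leq_trans (girth _ cyc) _; rewrite /= size_cat addnS !ltnS leq_addr.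
Qed.

Lemma nbw_rcons_path a y z p :
  path e z (rcons p a) -> uniq [:: a, y, z & p] -> nbw y z (rcons p a).
Proof.
elim: p y z => [|b p IHp] y z /=.
  by rewrite !inE !negb_or => /andP[-> _] /and3P[/andP[-> _] _ _].
rewrite !inE !negb_or => /andP[-> path_p].
case/and4P=> /and4P[_ az ab ap] /and3P[_ yb yp] /andP[zb zp] /andP[bp up].
rewrite eq_sym yb IHp //=; rewrite !inE !negb_or az ab ap zb zp bp up.
by [].
Qed.

(** Each induction step moves one vertex across the junction [a], where [nbw y a p] says that the
    two walks leave towards different vertices. *)
Lemma nbw_catrev y a p q :
  nbw y a p -> nbw a a (y :: q) ->
  exists t, catrev p [:: a, y & q] = last a p :: t /\ nbw (last a p) (last a p) t.
Proof.
elim: p a y q => [|b p IHp] a y q /=; first by exists (y :: q).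
case/and3P=> eab nby nb_p /and3P[eay nya nb_q]; apply: (IHp b a (y :: q)) => //=.
have ab : a != b by apply: contraTneq eab => ->; rewrite e_irr.
by rewrite e_sym eab ab eay eq_sym nby nb_q.
Qed.

(* Otherwise the two walks, glued at [y], form a closed nonbacktracking walk. *)
Lemma nbw_last_inj g y z z' p p' :
  girth_ge e g -> nbw y y (z :: p) -> nbw y y (z' :: p') ->
  (size p + size p').+2 < g -> last z p = last z' p' -> z = z'.
Proof.
move=> girth /= /and3P[eyz nzy nb_p] nb_p' lt_g eq_last.
apply/eqP/negPn/negP => neq_z.
have /(nbw_catrev nb_p) [t [t_def nb_t]] : nbw z z [:: y, z' & p'].
  case/and3P: nb_p' => eyz' _ nb_p' /=.
  by rewrite e_sym eyz eyz' eq_sym nzy eq_sym neq_z nb_p'.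
have size_t : size t < g.
  have := congr1 size t_def; rewrite catrevE size_cat size_rev /=; lia.
have := nbw_uniq girth nb_t size_t.
rewrite -t_def catrevE -cat_rcons -rev_cons cat_uniq => /and3P[_ /hasPn no_common _].
have := no_common (last z p); rewrite mem_rev mem_last.
by rewrite eq_last inE mem_last orbT => /(_ isT).
Qed.

Definition nbrs (x y : T) : seq T := [seq z <- enum T | e y z && (z != x)].

Fixpoint walks (r : nat) (x y : T) : seq (seq T) :=
  if r is r'.+1 then [seq z :: p | z <- nbrs x y, p <- walks r' y z]
  else [:: [::]].

Lemma walksP r x y p : p \in walks r x y -> size p = r /\ nbw x y p.
Proof.
elim: r x y p => [|r IHr] x y p /=; first by rewrite inE => /eqP ->.
case/allpairsPdep=> z [q [z_nbr /IHr[sz_q nb_q] ->]] /=.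
by move: z_nbr; rewrite mem_filter => /andP[/andP[-> ->] _]; rewrite sz_q.
Qed.

Section Misses.
Variable S : {set T}.

Definition misses (r : nat) (x y : T) : nat :=
  count (fun p => ~~ has [in S] p) (walks r x y).

Lemma missesS r x y :
  misses r.+1 x y = \sum_(z <- nbrs x y | z \notin S) misses r y z.
Proof.
rewrite /misses /= count_flatten sumnE !big_map [RHS]big_mkcond /=.
apply: eq_bigr => z _; rewrite count_map.
have [zS|zS] := boolP (z \in S).
  by rewrite -[RHS](count_pred0 (walks r y z)); apply: eq_count => p /=; rewrite zS.
by apply: eq_count => p /=; rewrite (negPf zS).
Qed.

(* The share of [v] among the walks hit by [S]: those whose first vertex in
   [S] is [v].  For large girth there is a unique way to reach [v]. *)
Fixpoint hits (r : nat) (x y v : T) : nat :=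
  if r is r'.+1 then
    \sum_(z <- nbrs x y) if z \in S then (z == v) * 2 ^ r' else hits r' y z v
  else 0.

(** Two neighbours with nonzero contributions would give short walks to [v] with different first
    steps, against [nbw_last_inj]; so at most one term survives. In a cubic graph the power of 2
    counts the continuations past [v]. *)
Lemma hitsP g r x y v :
  girth_ge e g -> 2 * r < g ->
  hits r x y v = 0 \/
  exists p, [/\ nbw x y (rcons p v), all [predC S] p, size p < r &
                hits r x y v = 2 ^ (r - (size p).+1)].
Proof.
move=> girth; elim: r x y => [|r IHr] x y lt_g /=; first by left.
have {}IHr x1 y1 := IHr x1 y1 ltac:(lia).
pose F z := if z \in S then (z == v) * 2 ^ r else hits r y z v.
have F_P z : z \in nbrs x y -> F z = 0 \/
    exists p, [/\ nbw x y (rcons p v), all [predC S] p, size p <= r,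
                F z = 2 ^ (r - size p) & z = head v p].
  rewrite mem_filter => /andP[/andP[eyz nzx] _]; rewrite /F.
  have [zS|zS] := boolP (z \in S).
    have [<-|_] := eqVneq z v; last by left; rewrite mul0n.
    by right; exists [::]; split; rewrite //= ?eyz ?nzx // subn0 mul1n.
  have [->|[p [nb_p pS lt_p ->]]] := IHr y z; first by left.
  right; exists (z :: p); split=> //=; first by rewrite eyz nzx.
  by rewrite zS.
have [allF0|] := boolP (all (fun z => F z == 0) (nbrs x y)).
  by left; rewrite big_seq big1 // => z /(allP allF0)/eqP.
case/allPn=> z z_nbr Fz; right.
have [/eqP|[p [nb_p pS le_p Fz_def z_def]]] := F_P z z_nbr; first by rewrite (negPf Fz).
exists p; split=> //; rewrite subSS -Fz_def.
have uniq_nbrs : uniq (nbrs x y) by rewrite filter_uniq ?enum_uniq.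
rewrite (bigD1_seq z) //= big_seq_cond big1 ?addn0 // => z' /andP[z'_nbr neq_z].
have [//|[p' [nb_p' _ le_p' _ z'_def]]] := F_P z' z'_nbr.
case/eqP: neq_z; rewrite z_def z'_def.
have rconsE q : exists2 t, rcons q v = head v q :: t &
    (size t = size q) /\ last (head v q) t = v.
  case: q => [|b q]; first by exists [::].
  by exists (rcons q v); rewrite ?size_rcons ?last_rcons.
have [t t_def [sz_t last_t]] := rconsE p; have [t' t'_def [sz_t' last_t']] := rconsE p'.
rewrite t_def in nb_p; rewrite t'_def in nb_p'.
apply: (nbw_last_inj girth (nbw_start nb_p') (nbw_start nb_p)).
  by rewrite sz_t sz_t'; lia.
by rewrite last_t last_t'.
Qed.

End Misses.
End NonBacktracking.

(** * The weight and the share of walks met *)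

Lemma sum_nat_const_seq (I : Type) (s : seq I) k : \sum_(i <- s) k = size s * k.
Proof. by rewrite big_const_seq count_predT iter_addn_0 mulnC. Qed.

Section Cubic.
Variables (T : finType) (e : rel T).
Hypotheses (e_sym : symmetric e) (e_irr : irreflexive e) (e_cubic : cubic e).

Lemma size_nbrs_start y : size (nbrs e y y) = 3.
Proof.
rewrite -(e_cubic y) cardE /nbrs size_filter -count_filter -size_filter enumT.
rewrite -filter_predI; congr size; apply: eq_filter => z /=; rewrite inE.
by rewrite andbC; case: eqVneq => [->|]; rewrite ?e_irr.
Qed.

Lemma size_nbrs x y : e x y -> size (nbrs e x y) = 2.
Proof.
move=> exy; have := e_cubic y; rewrite (cardsD1 x) inE e_sym exy => -[<-].
rewrite cardE size_filter enumT -size_filter; congr size.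
by apply: eq_filter => z; rewrite /= !inE andbC.
Qed.

Lemma size_walksS r x y k :
  (forall z, z \in nbrs e x y -> size (walks e r y z) = k) ->
  size (walks e r.+1 x y) = size (nbrs e x y) * k.
Proof.
move=> sz_k; rewrite size_allpairs_dep sumnE big_map big_seq.
by rewrite (eq_bigr _ sz_k) -big_seq sum_nat_const_seq.
Qed.

Lemma size_walks r x y : e x y -> size (walks e r x y) = 2 ^ r.
Proof.
elim: r x y => // r IHr x y exy; rewrite (size_walksS (k := 2 ^ r)).
  by rewrite (size_nbrs exy) expnS.
by move=> z; rewrite mem_filter => /andP[/andP[eyz _] _]; exact: IHr.
Qed.

Lemma size_walks_start r y : size (walks e r.+1 y y) = 3 * 2 ^ r.
Proof.
rewrite (size_walksS (k := 2 ^ r)) ?size_nbrs_start // => z.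
by rewrite mem_filter => /andP[/andP[eyz _] _]; exact: size_walks.
Qed.

(** Each walk misses [S] or is charged to its first vertex in [S]. The hypothesis covers walks with
    a past and walks without. *)
Lemma sum_hits (S : {set T}) r x y : e x y || (x == y) ->
  \sum_(v in S) hits e S r x y v + misses e S r x y = size (walks e r x y).
Proof.
elim: r x y => [|r IHr] x y exy; first by rewrite big1.
rewrite missesS /= exchange_big /= [X in _ + X]big_mkcond -big_split /=.
rewrite (@size_walksS r x y (2 ^ r)); last first.
  by move=> z; rewrite mem_filter => /andP[/andP[eyz _] _]; exact: size_walks.
rewrite -sum_nat_const_seq big_seq [RHS]big_seq; apply: eq_bigr => z.
rewrite mem_filter => /andP[/andP[eyz _] _].
have [zS|zS] := boolP (z \in S); last by rewrite IHr ?eyz // size_walks.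
rewrite (bigD1 z) //= eqxx mul1n big1 ?addn0 // => v /andP[_ /negPf].
by rewrite eq_sym => ->.
Qed.

Local Open Scope ring_scope.

Lemma distS_le (S : {set T}) u v p : u \notin S -> v \in S ->
  path e u (rcons p v) -> uniq (u :: rcons p v) -> all [predC S] p ->
  exists2 d, distS e S u v = Some d & (d <= (size p).+1)%N.
Proof.
move=> uS vS path_p uniq_p pS; rewrite /distS (negPf uS) vS /=.
(* The path has [size p + 2] distinct vertices, so its length lies in the range searched by
   [distS]. *)
have lt_card : ((size p).+1 < #|T|)%N.
  by move/card_uniqP: (uniq_p) => /=; rewrite size_rcons => <-; exact: max_card.
set k := find _ _; suff le_k : (k <= (size p).+1)%N.
  by exists k; rewrite // (leq_ltn_trans le_k).
rewrite leqNgt; apply/negP => lt_k; have := before_find 0%N lt_k.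
rewrite nth_iota // add0n => /existsP[]; have sz_p : size (rcons p v) == (size p).+1.
  by rewrite size_rcons.
exists (Tuple sz_p); apply/and3P; split=> //; last by rewrite /= last_rcons.
rewrite /=.
elim: p (u) uS pS path_p {uniq_p lt_card k lt_k sz_p} => [|w p IHp] y yS /=.
  by rewrite yS => _ /andP[->].
by rewrite yS => /andP[wS pS] /andP[-> path_p]; exact: IHp.
Qed.

(** If [v] is first met after [l] steps, it has [2 ^ (r + 1 - l)] hits and distance at most [l], so
    its hits divided by [2 ^ r] are at most its weight. Of the [3 * 2 ^ r] walks at least [2 ^ r]
    meet [S]. *)
Lemma expw_ge1 g r (S : {set T}) u :
  girth_ge e g -> (2 * r.+1 < g)%N -> u \notin S ->
  (misses e S r.+1 u u <= 2 ^ r.+1)%N -> 1 <= expw e S u.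
Proof.
move=> girth lt_g uS miss.
have term v : v \in S -> (hits e S r.+1 u u v)%:R / 2 ^+ r <=
    match distS e S u v with Some d => 2%:R / 2%:R ^+ d | None => 0 end :> rat.
  move=> vS; have [->|] := hitsP e_sym e_irr S u u v girth lt_g.
    by case: distS => [d|]; rewrite ?mul0r // divr_ge0 ?exprn_ge0.
  case=> p [nb_p pS lt_p ->].
  have uniq_p : uniq (u :: rcons p v).
    by apply: nbw_uniq girth nb_p _ => //; rewrite size_rcons; lia.
  have [d -> le_d] := distS_le uS vS (nbw_path nb_p) uniq_p pS.
  rewrite natrX ler_pdivrMr ?exprn_gt0 // mulrAC ler_pdivlMr ?exprn_gt0 //.
  by rewrite -exprD -exprS ler_weXn2l ?ler1n //; lia.
apply: le_trans (ler_sum _ term); rewrite -mulr_suml -natr_sum.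
rewrite ler_pdivlMr ?exprn_gt0 // mul1r -natrX ler_nat.
have := @sum_hits S r.+1 u u; rewrite eqxx orbT size_walks_start => /(_ isT).
by rewrite expnS in miss; lia.
Qed.

Lemma misses_sub (S S' : {set T}) r x y :
  S \subset S' -> (misses e S' r x y <= misses e S r x y)%N.
Proof.
move=> sSS'; apply: sub_count => p; apply: contra => /hasP[z pz zS].
by apply/hasP; exists z => //; exact: (subsetP sSS').
Qed.

End Cubic.

(** * Greedy covering of walks *)

Section GreedyCover.
Variables (T : finType) (W : seq (seq T)) (r : nat).
Hypothesis W_uniform : forall p, p \in W -> uniq p /\ size p = r.

Definition missed (S : {set T}) (p : seq T) : bool := ~~ has [in S] p.

Lemma missedU1 S v p : missed (v |: S) p = missed S p && (v \notin p).
Proof.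
rewrite /missed -negb_or; congr (~~ _); rewrite -has_pred1 -has_predU.
by apply: eq_has => z; rewrite /= !inE orbC.
Qed.

(** Double counting: a missed walk has [r] distinct vertices, so it stays missed for exactly
    [#|T| - r] choices of [v]. *)
Lemma sum_missed S :
  \sum_v count (missed (v |: S)) W = count (missed S) W * (#|T| - r).
Proof.
under eq_bigr => v _ do rewrite -sum1_count big_mkcond.
rewrite exchange_big -sum1_count big_distrl [RHS]big_mkcond /=.
rewrite big_seq [RHS]big_seq; apply: eq_bigr => p /W_uniform[uniq_p <-].
under eq_bigr => v _ do rewrite missedU1.
case: (missed S p) => /=; last by rewrite big1.
rewrite mul1n -big_mkcond sum1_card -(card_uniqP uniq_p) -(cardC [in p]) addKn.
by apply: eq_card => v; rewrite !inE.
Qed.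

Lemma greedy_cover k : 0 < #|T| ->
  exists2 S : {set T}, #|S| <= k &
    count (missed S) W * #|T| ^ k <= size W * (#|T| - r) ^ k.
Proof.
move=> T_gt0; elim: k => [|k [S le_S miss_S]].
  by exists set0; rewrite ?cards0 // !muln1 count_size.
(* Some [v] does at least as well as the average over all vertices. *)
have [v v_good] : exists v,
    count (missed (v |: S)) W * #|T| <= count (missed S) W * (#|T| - r).
  apply/existsP; apply: contraTT isT => /existsPn all_bad.
  have: \sum_(v : T) count (missed S) W * (#|T| - r) <
        \sum_v count (missed (v |: S)) W * #|T|.
    case/card_gt0P: T_gt0 => v0 _; rewrite (bigD1 v0) // [ltnRHS](bigD1 v0) //=.
    rewrite -addSn leq_add ?leq_sum // => [|v _].
      by rewrite ltnNge all_bad.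
    by rewrite ltnW // ltnNge all_bad.
  by rewrite sum_nat_const -big_distrl /= sum_missed mulnC ltnn.
exists (v |: S); first by rewrite cardsU1; case: (v \in S) => /=; lia.
rewrite !expnS mulnA (leq_trans (leq_mul v_good (leqnn _))) //.
by rewrite mulnAC [leqRHS]mulnCA [leqRHS]mulnC leq_mul2r miss_S orbT.
Qed.

End GreedyCover.

(** * Exponential domination from a partial cover *)

Lemma gamma_e_le (T : finType) (e : rel T) (S : {set T}) :
  exp_dominating e S -> gamma_e e <= #|S|.
Proof.
move=> domS; rewrite /gamma_e unlock; have: S \in index_enum {set T}.
  by rewrite mem_index_enum.
elim: (index_enum _) => //= S' s IHs; rewrite inE => /predU1P[<-|/IHs le_s].
  by rewrite domS geq_minl.
by case: ifP => _ //; rewrite geq_min le_s orbT.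
Qed.

(** A vertex of [S] already receives weight 2 from itself, at distance 0. *)
Lemma exp_dominatingP (T : finType) (e : rel T) (S : {set T}) :
  (forall u, u \notin S -> 1 <= expw e S u)%R -> exp_dominating e S.
Proof.
move=> domS; apply/forallP => u; have [uS|/domS//] := boolP (u \in S).
rewrite /expw (bigD1 u) //= {1}/distS !eqxx uS /= expr0 divr1.
apply: (@le_trans _ _ 2%R) => //; rewrite lerDl sumr_ge0 // => v _.
by case: distS => [d|//]; rewrite divr_ge0 ?exprn_ge0.
Qed.

Section Bound.
Variables (T : finType) (e : rel T).
Hypotheses (e_simple : simple_graph e) (e_cubic : cubic e).

(** Some nonbacktracking walk of length [r.+1] exists and has distinct vertices. This keeps the
    subtraction [#|T| - r.+1] from truncating. *)
Lemma girth_card g r : girth_ge e g -> r.+1 < g -> 0 < #|T| -> r < #|T|.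
Proof.
case: e_simple => e_sym e_irr girth lt_g /card_gt0P[u _].
have := size_walks_start e_sym e_irr e_cubic r u.
case W_def: (walks e r.+1 u u) => [|p W].
  by move/eqP; rewrite eq_sym muln_eq0 expn_eq0.
have /walksP[sz_p /nbw_uniq uniq_p] : p \in walks e r.+1 u u by rewrite W_def mem_head.
have /card_uniqP card_p := uniq_p e_irr g girth ltac:(by rewrite sz_p).
by have := max_card [in u :: p]; rewrite card_p /= sz_p => /ltnW.
Qed.

Lemma gamma_e_bound g r k : girth_ge e g -> 2 * r.+1 < g ->
  exists2 b, gamma_e e <= k + b &
    2 * b * #|T| ^ k <= 3 * #|T| * (#|T| - r.+1) ^ k.
Proof.
case: e_simple => e_sym e_irr girth lt_g.
have [T0|T_gt0] := posnP #|T|.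
  exists 0; rewrite ?muln0 // addn0 (leq_trans (gamma_e_le (S := set0) _)) ?cards0 //.
  by apply: exp_dominatingP => u; have := max_card (pred1 u); rewrite T0 card1.
pose W := [seq p | u <- enum T, p <- walks e r.+1 u u].
have W_uniform p : p \in W -> uniq p /\ size p = r.+1.
  case/allpairsPdep=> u [q [_ /walksP[sz_q nb_q] ->]]; split=> //.
  have := nbw_uniq e_irr girth nb_q; rewrite sz_q /= => uniq_q.
  by have /andP[] : (u \notin q) && uniq q by apply: uniq_q; lia.
have [S le_S missS] := greedy_cover W_uniform k T_gt0.
have szW : size W = #|T| * (3 * 2 ^ r).
  rewrite size_allpairs_dep sumnE big_map.
  under eq_bigr => u _ do rewrite size_walks_start //.
  by rewrite sum_nat_const_seq cardE.
have missW : count (missed S) W = \sum_u misses e S r.+1 u u.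
  rewrite /W /misses count_flatten sumnE !big_map -enumT big_enum; apply: eq_bigr => u _.
  by rewrite map_id.
(* At a bad vertex more than two thirds of the [3 * 2 ^ r] walks are missed; [le_bad] is Markov's
   inequality for their number. *)
pose bad := [set u | 2 ^ r.+1 < misses e S r.+1 u u].
exists #|bad|.
  have : exp_dominating e (S :|: bad).
    apply: exp_dominatingP => u; rewrite inE negb_or => /andP[uS].
    rewrite inE -leqNgt => miss_u.
    apply: (expw_ge1 e_sym e_irr e_cubic girth lt_g).
      by rewrite !inE negb_or uS -leqNgt.
    by apply: leq_trans miss_u; apply: misses_sub; exact: subsetUl.
  move/gamma_e_le/leq_trans; apply; rewrite cardsU; lia.
have le_bad : #|bad| * 2 ^ r.+1 <= count (missed S) W.
  rewrite missW -sum_nat_const [leqRHS](bigID [in bad]) /=.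
  by rewrite (leq_trans _ (leq_addr _ _)) // leq_sum // => u; rewrite inE => /ltnW.
rewrite szW in missS; rewrite -(leq_pmul2l (expn_gt0 2 r)).
have -> : 2 ^ r * (3 * #|T| * (#|T| - r.+1) ^ k) = #|T| * (3 * 2 ^ r) * (#|T| - r.+1) ^ k.
  by ring.
apply: leq_trans missS.
have -> : 2 ^ r * (2 * #|bad| * #|T| ^ k) = #|bad| * 2 ^ r.+1 * #|T| ^ k.
  by rewrite expnS; ring.
exact: leq_mul.
Qed.
End Bound.

(** * Cubic graphs of logarithmic girth *)

Section Reflections.
Local Open Scope ring_scope.

(* On [z = x / y] these are the reflections [- z], [2 - z] and [z / (2 z - 1)]
   in the sides of the ideal triangle with vertices 0, 1 and infinity. *)
Definition refl (R : comNzRingType) (i : 'I_3) (v : R * R) : R * R :=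
  match val i with
  | 0 => (- v.1, v.2)
  | 1 => (2 * v.2 - v.1, v.2)
  | _ => (v.1, 2 * v.1 - v.2)
  end.

Definition reflw (R : comNzRingType) (w : seq 'I_3) (v : R * R) : R * R :=
  foldl (fun v i => refl i v) v w.

Lemma ord3E (i : 'I_3) : [\/ val i = 0%N, val i = 1%N | val i = 2].
Proof. by case: i => [[|[|[|]]]] //= _; [constructor 1|constructor 2|constructor 3]. Qed.

Lemma reflK (R : comNzRingType) i : involutive (@refl R i).
Proof. by case=> x y; rewrite /refl; case: (ord3E i) => -> /=; congr pair; ring. Qed.

(** The arcs cut off by the triangle, [z < 0], [z > 1] and [0 < z < 1], with denominators cleared by
    the factor [y ^ 2]. *)
Definition side (i : 'I_3) (v : int * int) : bool :=
  match val i with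
  | 0 => v.1 * v.2 < 0
  | 1 => 0 < (v.1 - v.2) * v.2
  | _ => 0 < v.1 * (v.2 - v.1)
  end.

(** The ping-pong move: a reflection exchanges the two sides of its geodesic, and the other two arcs
    lie on the side away from arc [i]. *)
Lemma side_refl i j v : i != j -> side j v -> side i (refl i v).
Proof.
case: v => x y; rewrite -val_eqE /side /refl.
by case: (ord3E i) => ->; case: (ord3E j) => -> //= _; nia.
Qed.

Lemma side_disjoint i j v : side i v -> side j v -> i = j.
Proof.
case: v => x y; rewrite /side => si sj; apply: val_inj; move: si sj.
by case: (ord3E i) => ->; case: (ord3E j) => -> //=; nia.
Qed.

Definition side_rep (i : 'I_3) : int * int :=
  match val i with 0 => (-1, 1) | 1 => (2, 1) | _ => (1, 2) end.

Lemma side_repP i : side i (side_rep i).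
Proof. by rewrite /side /side_rep; case: (ord3E i) => ->. Qed.

Lemma side_reflw i j w v : j != i -> side j v -> path (fun i j => i != j) i w ->
  side (last i w) (reflw (i :: w) v).
Proof.
elim: w i j v => [|k w IHw] i j v neq_ji sv /=.
  by move=> _; apply: side_refl sv; rewrite eq_sym.
case/andP=> neq_ik /(IHw k i (refl i v)); apply=> //.
by apply: side_refl sv; rewrite eq_sym.
Qed.

(** Of the three arcs, choose one that belongs neither to the first letter, so that ping-pong
    starts, nor to the last, so that it ends in a different arc. *)
Lemma reflw_neq i w : path (fun i j => i != j) i w ->
  exists j, reflw (i :: w) (side_rep j) != side_rep j.
Proof.
move=> reduced_w.
have [j]: exists j : 'I_3, j \notin [:: i; last i w].
  apply/existsP; rewrite -negb_forall; apply/negP => /forallP sub.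
  have := leq_trans (subset_leq_card _) (card_size [:: i; last i w]).
  by move=> /(_ predT)/=; rewrite card_ord => /(_ (introT subsetP (fun j _ => sub j))).
rewrite !inE negb_or => /andP[neq_i neq_last]; exists j.
apply: contra neq_last => /eqP fix_j; apply/eqP.
apply: (side_disjoint (side_repP j)); rewrite -[side_rep j]fix_j.
exact: side_reflw neq_i (side_repP j) reduced_w.
Qed.

Lemma refl_bound (b : int) i v : `|v.1| <= b -> `|v.2| <= b ->
  `|(refl i v).1| <= 3 * b /\ `|(refl i v).2| <= 3 * b.
Proof. by case: v => x y; rewrite /refl; case: (ord3E i) => -> /=; lia. Qed.

Lemma reflw_bound (b : int) w v : `|v.1| <= b -> `|v.2| <= b ->
  `|(reflw w v).1| <= 3 ^+ size w * b /\ `|(reflw w v).2| <= 3 ^+ size w * b.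
Proof.
elim: w b v => [|i w IHw] b v v1 v2; first by rewrite !mul1r.
have [r1 r2] := refl_bound i v1 v2.
by rewrite /= exprSr -mulrA; exact: IHw.
Qed.

Section Linear.
Variable R : comNzRingType.

Definition lincomb (a b : R) (u v : R * R) : R * R :=
  (a * u.1 + b * v.1, a * u.2 + b * v.2).

Lemma reflw_lincomb w a b u v :
  reflw w (lincomb a b u v) = lincomb a b (reflw w u) (reflw w v).
Proof.
elim: w u v => //= i w IHw u v.
suff -> : refl i (lincomb a b u v) = lincomb a b (refl i u) (refl i v) by exact: IHw.
case: u v => [x y] [z t].
by rewrite /refl /lincomb; case: (ord3E i) => -> /=; congr pair; ring.
Qed.

Definition det2 (u v : R * R) : R := u.1 * v.2 - u.2 * v.1.

Lemma det2_refl i u v : det2 (refl i u) (refl i v) = - det2 u v.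
Proof.
case: u v => [x y] [z t]; rewrite /refl /det2.
by case: (ord3E i) => -> /=; ring.
Qed.

(* Cramer's rule *)
Lemma reflw_fixed w (u v t : R * R) : det2 u v ^+ 2 = 1 ->
  reflw w u = u -> reflw w v = v -> reflw w t = t.
Proof.
move=> det1 fix_u fix_v; pose a := det2 u v * det2 t v; pose b := det2 u v * det2 u t.
suff -> : t = lincomb a b u v by rewrite reflw_lincomb fix_u fix_v.
move: det1; rewrite /a /b /lincomb.
case: t u v {a b fix_u fix_v} => [x y] [u1 u2] [v1 v2] /= det1.
congr pair.
  by rewrite -[LHS]mul1r -det1 /det2 /=; ring.
by rewrite -[LHS]mul1r -det1 /det2 /=; ring.
Qed.

End Linear.

Lemma reflw_map (R S : comNzRingType) (f : {rmorphism R -> S}) w v :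
  reflw w (f v.1, f v.2) = (f (reflw w v).1, f (reflw w v).2).
Proof.
elim: w v => [|i w IHw] v //=; rewrite -IHw.
suff -> : refl i (f v.1, f v.2) = (f (refl i v).1, f (refl i v).2) by [].
case: v => x y; rewrite /refl; case: (ord3E i) => -> /=; congr pair;
  by rewrite ?rmorphN ?rmorphB ?rmorphM ?rmorph_nat.
Qed.

Lemma intr_Zp_eq m (a b : int) : (1 < m)%N -> (`|a| + `|b| < m)%R ->
  a%:~R = b%:~R :> 'Z_m -> a = b.
Proof.
move=> m_gt1 lt_m /eqP; rewrite -subr_eq0 -rmorphB /=.
have /= : ((absz (a - b))%:R == 0 :> 'Z_m) = (m %| absz (a - b))%N.
  by rewrite -val_eqE /= val_Zp_nat.
have -> : ((a - b)%:~R == 0 :> 'Z_m) = ((absz (a - b))%:R == 0 :> 'Z_m).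
  case: (intP (a - b)) => [|n|n] //; by rewrite rmorphN oppr_eq0.
move=> -> /dvdn_leq; lia.
Qed.

End Reflections.

(** * The graph of the reflections modulo [m] *)

Section ReflectionGraph.
Variable m : nat.
Hypothesis m_gt20 : 20 < m.

Lemma m_gt1 : 1 < m. Proof. exact: leq_trans m_gt20. Qed.

Local Open Scope ring_scope.

(** Squaring the determinant absorbs the sign change caused by each reflection. *)
Definition unimodular (x : ('Z_m * 'Z_m) * ('Z_m * 'Z_m)) : bool :=
  det2 x.1 x.2 ^+ 2 == 1.

Definition frame : finType := {x | unimodular x}.

Lemma frefl_subproof i (x : frame) :
  unimodular (refl i (val x).1, refl i (val x).2).
Proof. by rewrite /unimodular det2_refl sqrrN; exact: valP x. Qed.

Definition frefl (i : 'I_3) (x : frame) : frame :=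
  exist unimodular _ (frefl_subproof i x).

Definition fadj (x y : frame) : bool := [exists i, y == frefl i x].

Lemma freflK i : involutive (frefl i).
Proof. by move=> x; apply: val_inj; rewrite /= !reflK; case: (val x). Qed.

Lemma val_foldl_frefl w x :
  val (foldl (fun v i => frefl i v) x w) = (reflw w (val x).1, reflw w (val x).2).
Proof. by elim: w x => [|i w IHw] x /=; [case: (val x) | rewrite IHw]. Qed.

(** A word fixing a frame fixes every vector modulo [m], in particular [side_rep j]. The entries of
    [side_rep j] are at most 2 and those of its integer image at most [2 * 3 ^ (size w).+1], so the
    congruence is an equality, against [reflw_neq]. *)
Lemma frefl_free i w x : path (fun i j => i != j) i w ->
  (2 * 3 ^ (size w).+1 + 2 < m)%N -> foldl (fun v i => frefl i v) x (i :: w) <> x.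
Proof.
move=> /reflw_neq[j neq_j] lt_m /(congr1 val); rewrite val_foldl_frefl.
move: (valP x); case: (val x) => u v /= /eqP det1 [fix_u fix_v].
set t := side_rep j in neq_j.
have t1 : `|t.1| <= 2 by rewrite /t /side_rep; case: (ord3E j) => ->.
have t2 : `|t.2| <= 2 by rewrite /t /side_rep; case: (ord3E j) => ->.
have [r1 r2] := reflw_bound (i :: w) t1 t2.
have := @reflw_fixed _ (i :: w) u v (t.1%:~R, t.2%:~R) det1 fix_u fix_v.
rewrite (reflw_map intr) => -[eq1 eq2]; case/eqP: neq_j.
have {}lt_m : 3 ^+ size (i :: w) * 2 + 2 < m :> int.
  by rewrite -natrX natz /=; move: lt_m; set k := (3 ^ _)%N; lia.
rewrite [LHS]surjective_pairing [RHS]surjective_pairing; congr pair.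
  apply: (intr_Zp_eq m_gt1) eq1; apply: le_lt_trans lt_m; exact: lerD.
apply: (intr_Zp_eq m_gt1) eq2; apply: le_lt_trans lt_m; exact: lerD.
Qed.

(** A coincidence would give a two-letter word fixing [x]; [frefl_free] excludes it since
    [2 * 3 ^ 2 + 2 = 20 < m]. *)
Lemma frefl_inj x : injective (frefl^~ x).
Proof.
move=> i j /= eq_ij; apply/eqP/negPn/negP => neq_ij.
apply: (@frefl_free i [:: j] x); rewrite /= ?neq_ij //.
by rewrite eq_ij freflK.
Qed.

Lemma fadj_simple : simple_graph fadj.
Proof.
split=> [x y|x]; last first.
  apply: contraTF isT => /existsP[i /eqP/esym fix_i].
  by case: (@frefl_free i [::] x isT (@leq_trans 21 9 m isT m_gt20) fix_i).
by apply/existsP/existsP => -[i /eqP ->]; exists i; rewrite freflK.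
Qed.

Lemma fadj_cubic : cubic fadj.
Proof.
move=> x; rewrite -[RHS]card_ord -(card_imset predT (@frefl_inj x)).
apply: eq_card => y; rewrite inE; apply/existsP/imsetP => [[i /eqP ->]|[i _ ->]].
  by exists i.
by exists i.
Qed.

(** Reflections are involutions, so repeating a colour would mean backtracking. *)
Lemma nbw_colors x i p : nbw fadj x (frefl i x) p ->
  exists w, [/\ path (fun i j => i != j) i w, size w = size p &
    last (frefl i x) p = foldl (fun v i => frefl i v) (frefl i x) w].
Proof.
elim: p x i => [|z p IHp] x i /=; first by exists [::].
case/and3P=> /existsP[k /eqP ->] neq_x /IHp[w [red_w sz_w last_w]].
exists (k :: w); split=> //=; last by rewrite sz_w.
by rewrite red_w andbT; apply: contraNneq neq_x => ->; rewrite freflK.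
Qed.

Lemma fadj_girth L : (2 * 3 ^ L + 2 < m)%N -> girth_ge fadj L.
Proof.
move=> lt_m [|x [|y [|z p]]] [//= _ [uniq_c cyc_c]]; rewrite leqNgt; apply/negP => lt_L.
move: cyc_c => /= /and3P[/existsP[i /eqP y_def] eyz path_c].
(* Appending [x] closes the cycle, whose colours then spell a reduced word fixing [x]. *)
have : nbw fadj x y (z :: rcons p x).
  rewrite /= eyz (nbw_rcons_path path_c) ?andbT //.
    by move: uniq_c; rewrite /= !inE !negb_or => /and4P[/and3P[_ + _]]; rewrite eq_sym.
rewrite {1}y_def => /nbw_colors[w [red_w sz_w last_w]].
apply: (@frefl_free i w x red_w); last by rewrite /= -last_w /= last_rcons.
apply: leq_ltn_trans lt_m; rewrite leq_add2r leq_mul2l leq_pexp2l //.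
by rewrite sz_w /= size_rcons ltnW.
Qed.

Lemma card_frame_le : (#|frame| <= m ^ 4)%N.
Proof.
rewrite card_sub (leq_trans (max_card _)) // !card_prod !card_ord (Zp_cast m_gt1).
by rewrite leq_eqVlt; apply/orP; left; apply/eqP; ring.
Qed.

Lemma card_frame_ge : (m <= #|frame|)%N.
Proof.
have det1 (k : 'Z_m) : unimodular ((1, 0), (k, 1)).
  by rewrite /unimodular /det2 /= mulr1 mul0r subr0 expr1n.
have inj : injective (fun k => exist unimodular _ (det1 k) : frame) by move=> k l [].
by have := leq_card _ inj; rewrite card_ord (Zp_cast m_gt1).
Qed.

End ReflectionGraph.

Lemma cubic_large_girth L : 1 < L ->
  exists (T : finType) (e : rel T),
    [/\ simple_graph e, cubic e, girth_ge e L & 3 ^ L <= #|T| <= 3 ^ (4 * (L + 2))].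
Proof.
move=> L_gt1; have L9 : 3 ^ 2 <= 3 ^ L by rewrite leq_exp2l.
(* The modulus [9 * 3 ^ L] exceeds both 20 and [2 * 3 ^ L + 2], and its fourth power bounds the
   order of the graph. *)
have m_gt20 : 20 < 3 ^ (L + 2) by rewrite expnD; lia.
exists (frame (3 ^ (L + 2))), (@fadj (3 ^ (L + 2))); split.
- exact: fadj_simple.
- exact: fadj_cubic.
- by apply: fadj_girth => //; rewrite expnD; lia.
- rewrite mulnC expnM card_frame_le // (leq_trans _ (card_frame_ge m_gt20)) //.
  by rewrite leq_exp2l ?leq_addr.
Qed.

(** * Real estimates *)

From Stdlib Require Import ZArith Reals Lra.
From Coquelicot Require Import Rcomplements.
Open Scope R_scope.

Lemma INR_expn m k : INR (expn m k) = INR m ^ k.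
Proof. by elim: k => // k IHk; rewrite expnS mult_INR IHk. Qed.

Lemma INR_leq m n : (m <= n)%nat -> INR m <= INR n.
Proof. by move/ssrnat.leP/le_INR. Qed.

Lemma INR_gt0 n : (0 < n)%nat -> 0 < INR n.
Proof. by move/ssrnat.ltP/lt_0_INR. Qed.

Lemma exp_pow x k : exp x ^ k = exp (INR k * x).
Proof.
elim: k => [|k IHk]; first by rewrite Rmult_0_l exp_0.
by rewrite S_INR /= IHk -exp_plus; congr exp; lra.
Qed.

Lemma pow_one_minus_le x k : 0 <= x <= 1 -> (1 - x) ^ k <= exp (- (INR k * x)).
Proof.
move=> x01; rewrite Ropp_mult_distr_r -exp_pow.
by apply: pow_incr; have := exp_ineq1_le (- x); lra.
Qed.

Lemma nat_above (x : R) : 0 <= x -> exists k, x <= INR k <= x + 1.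
Proof.
move=> x_ge0; have [gt_x le_x] := archimed x.
have up_ge0 : (0 <= up x)%Z by apply: le_IZR; lra.
by exists (Z.to_nat (up x)); rewrite INR_IZR_INZ Z2Nat.id //; lra.
Qed.

Lemma ln_le_sub1 x : 0 < x -> ln x <= x - 1.
Proof. by move=> x0; have := exp_ineq1_le (ln x); rewrite exp_ln //; lra. Qed.

Lemma exp_le x y : x <= y -> exp x <= exp y.
Proof. by case=> [/exp_increasing/Rlt_le|->] //; apply: Rle_refl. Qed.

Lemma ln_ge0 x : 1 <= x -> 0 <= ln x.
Proof. by move=> x1; rewrite -ln_1; apply: ln_le; lra. Qed.

Lemma gamma_e_ln_bound (T : finType) (e : rel T) g r :
  simple_graph e -> cubic e -> girth_ge e g -> (2 * r < g)%nat -> (0 < r)%nat ->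
  INR (gamma_e e) <= INR #|T| * ((ln (INR r) + 5 / 2) / INR r).
Proof.
case: r => // r simple cub girth lt_g _.
have [T0|T_gt0] := posnP #|T|.
  have [b] := gamma_e_bound simple cub 0%nat girth lt_g.
  rewrite T0 !muln0 !muln1 leqn0 muln_eq0 /= => le_b /eqP b0.
  by move: le_b; rewrite b0 leqn0 => /eqP ->; rewrite Rmult_0_l; apply: Rle_refl.
have le_rn : (r < #|T|)%nat.
  apply: (girth_card simple cub girth) => //.
  exact: leq_ltn_trans (leq_pmull _ (isT : 0 < 2)%nat) lt_g.
set n := #|T| in T_gt0 le_rn *.
have n_gt0 := INR_gt0 T_gt0; have r_gt0 : 0 < INR r.+1 by exact: INR_gt0.
have le_rn_INR : INR r.+1 <= INR n by apply: INR_leq.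
have ln_r : 0 <= ln (INR r.+1) by apply/ln_ge0/(INR_leq (isT : 1 <= r.+1)%nat).
(* This [k] makes the exponential factor at most [1 / r.+1]. *)
have [k [ge_k le_k]] : exists k,
    INR n * (ln (INR r.+1) / INR r.+1) <= INR k <=
    INR n * (ln (INR r.+1) / INR r.+1) + 1.
  apply: nat_above; apply: Rmult_le_pos; first lra.
  by apply: Rdiv_le_0_compat.
have [b le_b miss_b] := gamma_e_bound simple cub k girth lt_g.
have x01 : 0 <= INR r.+1 / INR n <= 1.
  split; first by apply: Rdiv_le_0_compat; lra.
  exact/(Rdiv_le_1 _ _ n_gt0).
have b_le : INR b <= 3 / 2 * (INR n * / INR r.+1).
  have nk_gt0 : 0 < INR n ^ k by apply: pow_lt.
  have := INR_leq miss_b; rewrite !mult_INR !INR_expn -/n minus_INR; last first.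
    exact/ssrnat.leP.
  have -> : INR n - INR r.+1 = INR n * (1 - INR r.+1 / INR n) by field; lra.
  rewrite Rpow_mult_distr => b_le.
  have {}b_le : 2 * INR b <= 3 * INR n * (1 - INR r.+1 / INR n) ^ k.
    by apply: (Rmult_le_reg_r (INR n ^ k)) => //; move: b_le; rewrite /=; lra.
  have le_exp : exp (- (INR k * (INR r.+1 / INR n))) <= / INR r.+1.
    rewrite -[X in / X]exp_ln // -exp_Ropp; apply: exp_le; apply: Ropp_le_contravar.
    have -> : ln (INR r.+1) = INR n * (ln (INR r.+1) / INR r.+1) * (INR r.+1 / INR n).
      by field; lra.
    by apply: Rmult_le_compat_r => //; lra.
  have := Rle_trans _ _ _ (pow_one_minus_le k x01) le_exp.
  move/(Rmult_le_compat_l (INR n) _ _ (Rlt_le _ _ n_gt0)); lra.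
have : INR (gamma_e e) <= INR k + INR b by rewrite -plus_INR; apply: INR_leq.
(* This absorbs the rounding of [k]; together with the bad vertices it gives [1 + 3 / 2 = 5 / 2]. *)
have : 1 <= INR n * / INR r.+1.
  by apply: (Rmult_le_reg_r (INR r.+1)) => //; rewrite Rmult_assoc Rinv_l; lra.
rewrite /Rdiv in ge_k le_k *; rewrite Rmult_plus_distr_r Rmult_plus_distr_l; lra.
Qed.

Lemma ln_growth d C : 0 < d -> 0 < C ->
  exists x0, forall x, x0 <= x -> 1 <= x -> ln x + 5 / 2 <= C * Rpower x d.
Proof.
move=> d_gt0 C_gt0; pose K := (2 / d + 5 / 2) / C.
(* With [t] the power [d / 2] of [x], this threshold forces [t >= K], and [C * K = 2 / d + 5 / 2]
   lets [C * t ^ 2] dominate both terms. *)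
exists (exp (2 / d * K)) => x le_x x1.
have lnx : 2 / d * K <= ln x.
  by rewrite -[X in X <= _]ln_exp; apply: ln_le => //; exact: exp_pos.
pose t := Rpower x (d / 2); have t2 : Rpower x d = t * t.
  by rewrite -Rpower_plus; congr Rpower; field.
have t_gt0 : 0 < t by apply: exp_pos.
have lnt : ln t = d / 2 * ln x by rewrite ln_exp.
have lnt_le := ln_le_sub1 t_gt0.
have lnx_eq : ln x = 2 / d * ln t by rewrite lnt; field; lra.
have lnt_ge0 : 0 <= ln t by rewrite lnt; apply: Rmult_le_pos; [lra | apply: ln_ge0].
have tK : K <= t.
  have : d / 2 * (2 / d * K) <= d / 2 * ln x by apply: Rmult_le_compat_l; lra.
  have -> : d / 2 * (2 / d * K) = K by field; lra.
  lra.
have d2 : 0 < 2 / d by apply: Rdiv_lt_0_compat; lra.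
rewrite t2 lnx_eq; have CK : C * K = 2 / d + 5 / 2 by rewrite /K; field; lra.
have le_tt : C * K * t <= C * t * t.
  by apply: Rmult_le_compat_r; [lra | apply: Rmult_le_compat_l; lra].
have le_t : 2 / d * ln t <= 2 / d * t by apply: Rmult_le_compat_l; lra.
by rewrite CK in le_tt; lra.
Qed.

Lemma ln2_gt : 2 / 3 < ln 2.
Proof.
(* The exponent is cut into ten parts because [(15 / 14) ^ 10 < 2]. *)
have le1 : exp (1 / 15) <= 15 / 14.
  have := exp_ineq1_le (- (1 / 15)); rewrite exp_Ropp => le_inv.
  have e_gt0 := exp_pos (1 / 15).
  have : exp (1 / 15) * / exp (1 / 15) = 1 by apply: Rinv_r; lra.
  nra.
rewrite -[X in X < _]ln_exp; apply: ln_increasing; first exact: exp_pos.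
have -> : exp (2 / 3) = exp (1 / 15) ^ 10.
  by rewrite exp_pow; congr exp; simpl; lra.
apply: Rle_lt_trans (pow_incr _ _ _ (conj (Rlt_le _ _ (exp_pos _)) le1)) _.
by lra.
Qed.

Theorem theorem6 :
  (forall eps : R, 0 < eps ->
     exists g : nat,
       forall (T : finType) (e : rel T),
         simple_graph e -> cubic e -> girth_ge e g ->
         INR (gamma_e e) <= eps * INR #|T|)
  /\
  (forall alpha : R, 0 < alpha < 2 / (3 * ln 2) ->
     forall N : nat,
       exists (T : finType) (e : rel T),
         simple_graph e /\ cubic e /\ (N <= #|T|)%nat /\
         INR (gamma_e e) <= 3 * INR #|T| / Rpower (ln (INR #|T|)) alpha).
Proof.
split=> [eps eps_gt0|alpha alpha01 N].
  have [x0 growth] := ln_growth Rlt_0_1 eps_gt0.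
  have [r [le_r _]] := nat_above (Rmax_l 0 x0).
  exists (2 * r.+1).+1 => T e simple cub girth.
  have r1 : 1 <= INR r.+1 by apply: (INR_leq (isT : 1 <= r.+1)%nat).
  have le_x0 : x0 <= INR r.+1.
    by rewrite S_INR; have := Rmax_r 0 x0; lra.
  apply: Rle_trans (gamma_e_ln_bound simple cub girth (ltnSn _) isT) _.
  rewrite Rmult_comm; apply: Rmult_le_compat_r; first exact: pos_INR.
  apply/(Rle_div_l _ _ (INR r.+1)); first lra.
  by have := growth _ le_x0 r1; rewrite Rpower_1; lra.
have alpha1 : alpha < 1.
  apply: Rlt_le_trans (proj2 alpha01) _; have := ln2_gt => ln2.
  by apply/(Rdiv_le_1 2 (3 * ln 2)); lra.
(* The constant is 3 over [Rpower 40 alpha], where 40 is the factor in [ln_n_le] below. *)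
have [x0 growth] := ln_growth (proj2 (Rlt_0_minus alpha 1) alpha1)
  (Rdiv_lt_0_compat 3 _ ltac:(lra) (exp_pos (alpha * ln 40))).
have [s [le_s _]] := nat_above (Rmax_l 0 x0).
(* The summand [N] makes the graphs arbitrarily large. *)
pose r := (s + N).+1; have r1 : 1 <= INR r by apply: (INR_leq (isT : 1 <= r)%nat).
have le_x0 : x0 <= INR r.
  by rewrite /r S_INR plus_INR; have := Rmax_r 0 x0; have := pos_INR N; lra.
have [T [e [simple cub girth /andP[ge_n le_n]]]] :=
  cubic_large_girth (isT : 1 < (2 * r).+1)%nat.
have le_rn : (r < #|T|)%nat.
  apply: leq_trans ge_n; apply: leq_ltn_trans (ltn_expl _ (isT : 1 < 3)%nat).
  by lia.
exists T, e; do 3 split=> //.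
  by apply: ltnW; apply: leq_trans le_rn; rewrite /r; lia.
have lt_rn : INR r < INR #|T| by apply/lt_INR/ssrnat.ltP.
have ln_n_gt0 : 0 < ln (INR #|T|) by rewrite -ln_1; apply: ln_increasing; lra.
(* From [ln 3 <= 2] and [r >= 1]: the exponent [8 * r + 12] gives [16 * r + 24 <= 40 * r]. *)
have ln_n_le : ln (INR #|T|) <= 40 * INR r.
  have n_gt0 : 0 < INR #|T| by lra.
  have := ln_le _ _ n_gt0 (INR_leq le_n); rewrite INR_expn => ln_le_pow.
  apply: Rle_trans ln_le_pow _; rewrite ln_pow; last by simpl; lra.
  have := ln_le_sub1 (INR_gt0 (isT : 0 < 3)%nat).
  have -> : INR 3 - 1 = 2 by simpl; lra.
  have -> : INR (4 * ((2 * r).+1 + 2)) = 8 * INR r + 12.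
    by rewrite mult_INR plus_INR (S_INR (2 * r)) mult_INR; simpl; lra.
  by nra.
apply: Rle_trans (gamma_e_ln_bound simple cub girth (ltnSn _) isT) _.
have pow_le : Rpower (ln (INR #|T|)) alpha <= Rpower 40 alpha * Rpower (INR r) alpha.
  by rewrite Rpower_mult_distr; try lra; apply: Rle_Rpower_l; lra.
have := growth _ le_x0 r1; rewrite -[exp _]/(Rpower 40 alpha).
have := pow_le; set p := Rpower _ alpha.
set q := Rpower 40 alpha; set t := Rpower (INR r) alpha.
have [p0 [q0 t0]] : 0 < p /\ 0 < q /\ 0 < t by split; [|split]; apply: exp_pos.
have -> : Rpower (INR r) (1 - alpha) = INR r / t.
  by rewrite /Rminus Rpower_plus Rpower_1 ?Rpower_Ropp //; lra.
move=> le_p le_ln.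
rewrite /Rdiv (Rmult_comm 3) Rmult_assoc; apply: Rmult_le_compat_l; first exact: pos_INR.
apply: (@Rle_trans _ (3 / (q * t))).
  apply/(Rle_div_l _ _ (INR r)); first lra.
  by apply: Rle_trans le_ln _; apply: Req_le; field; lra.
by apply: Rmult_le_compat_l; [lra | apply: Rinv_le_contravar; lra].
Qed.
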